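(* Let $(M,g,S)$ be a four-dimensional Riemannian manifold with a skew-circulant structure $S$ (as defined in the context) whose curvature tensor satisfies $R(Sx,Sy,Sz,Su)=R(x,y,z,u)$ for all $x,y,z,u$. Let $p\in M$. If a vector $x\in T_pM$ induces an $S$-basis of $T_pM$, then the sectional curvatures of the basic $2$-planes satisfy $$k(x,Sx)=k(Sx,S^{2}x)=k(S^{2}x,S^{3}x)=k(S^{3}x,x),$$ $$k(x,S^{2}x)=k(Sx,S^{3}x).$$
   Context: Throughout, $(M,g,S)$ denotes a $4$-dimensional differentiable manifold $M$ with a Riemannian metric $g$ and a tensor $S$ of type $(1,1)$ whose components with respect to the local basis $\{e_1,e_2,e_3,e_4\}$ form the right skew-circulant matrix $$(S_i^j)=\begin{pmatrix}0&1&0&0\\ 0&0&1&0\\ 0&0&0&1\\ -1&0&0&0\end{pmatrix},\qquad Se_i=S_i^j e_j,$$ so $S^4=-\mathrm{id}$. $S$ is assumed to be an isometry: $g(Sx,Sy)=g(x,y)$. Consequently the components $g_{ij}=g(e_i,e_j)$ are $$(g_{ij})=\begin{pmatrix} A & B & 0 & -B \\ B & A & B & 0 \\ 0 & B & A & B \\ -B & 0 & B & A \end{pmatrix}$$ with smooth functions $A,B$, where it is supposed that $A>\sqrt2\,B>0$ (so $g$ is positive definite). Here $x,y,z,u$ are arbitrary smooth vector fields on $M$ or vectors in a tangent space $T_pM$. $\nabla$ is the Levi-Civita connection of $g$, $R(x,y)z=\nabla_x\nabla_y z-\nabla_y\nabla_x z-\nabla_{[x,y]}z$, and $R(x,y,z,u)=g(R(x,y)z,u)$.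 For linearly independent $x,y\in T_pM$ the sectional curvature of the $2$-plane $\{x,y\}$ is, with the sign convention used here, $$k(x,y)=\frac{R(x,y,x,y)}{g(x,x)g(y,y)-g^2(x,y)}.$$ A vector $x\in T_pM$ induces an $S$-basis of $T_pM$ if $\{S^3x,S^2x,Sx,x\}$ is a basis of $T_pM$; the basic $2$-planes are those spanned by pairs of these basis vectors. *)

(* Defs.v *)
From HB Require Import structures.
From mathcomp Require Import all_boot all_order all_algebra.
From mathcomp Require Import all_classical all_reals all_analysis.

Set Implicit Arguments.
Unset Strict Implicit.
Unset Printing Implicit Defensive.

Import Order.TTheory GRing.Theory Num.Theory.
Import numFieldNormedType.Exports.

Local Open Scope classical_set_scope.
Local Open Scope ring_scope.

Section SmoothFunctions.
Variable R : realType.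
Local Notation E := 'rV[R]_4.

Definition partial (i : 'I_4) (f : E -> R) : E -> R :=
  fun x => 'D_(delta_mx 0 i) f x.

(* [U] is meant to be open: the partial derivatives see a neighbourhood of
   the points of [U]. *)
Fixpoint Ck_on (k : nat) (U : set E) (f : E -> R) : Prop :=
  (forall x, U x -> {for x, continuous f}) /\
  match k with
  | 0 => True
  | k'.+1 => forall i : 'I_4,
      (forall x, U x -> derivable f x (delta_mx 0 i)) /\
      Ck_on k' U (partial i f)
  end.

Definition smooth_on (U : set E) (f : E -> R) : Prop :=
  forall k, Ck_on k U f.

End SmoothFunctions.

Record chart (R : realType) (M : topologicalType) := Chart {
  chart_dom : set M;
  chart_map : M -> 'rV[R]_4;
  chart_inv : 'rV[R]_4 -> M;
  chart_dom_open : open chart_dom;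
  chart_img_open : open (chart_map @` chart_dom);
  chart_mapK : forall q, chart_dom q -> chart_inv (chart_map q) = q;
  chart_map_continuous : {within chart_dom, continuous chart_map};
  chart_inv_continuous :
    {within chart_map @` chart_dom, continuous chart_inv}
}.

Record manifold4 (R : realType) := Manifold4 {
  carrier :> topologicalType;
  manifold_hausdorff : hausdorff_space carrier;
  manifold_second_countable : @second_countable carrier;
  atlas : set (chart R carrier);
  atlas_cover : forall p : carrier, exists2 c, atlas c & chart_dom c p;
  atlas_smooth : forall c c', atlas c -> atlas c' -> forall i : 'I_4,
    smooth_on (chart_map c @` (chart_dom c `&` chart_dom c'))
              (fun x => chart_map c' (chart_inv c x) 0 i)
}.

Section TangentSpace.
Variables (R : realType) (M : manifold4 R).

Definition smooth_in (W : set M) (f : M -> R) : Prop :=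
  forall c, atlas c ->
  smooth_on (chart_map c @` (chart_dom c `&` W)) (f \o chart_inv c).

(* [f] represents a germ at [p]: nothing is required away from [p]. *)
Definition smooth_at (p : M) (f : M -> R) : Prop :=
  exists W : set M, [/\ open W, W p & smooth_in W f].

(* Derivations of the algebra of germs at [p] of smooth functions. The first
   clause normalizes [v] off the functions smooth at [p], so that two
   functionals with the same action on germs are equal; the Leibniz rule
   (applied to indicators of complements of neighbourhoods of [p]) makes [v f]
   depend on the germ of [f] only. *)
Definition derivation_at (p : M) (v : (M -> R) -> R^o) : Prop :=
  [/\ forall f, ~ smooth_at p f -> v f = 0,
      forall (a : R) f h, smooth_at p f -> smooth_at p h ->
        v (fun q => a * f q + h q) = a * v f + v h
    & forall f h, smooth_at p f -> smooth_at p h ->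
        v (fun q => f q * h q) = v f * h p + f p * v h].

Definition tangent_pred (p : M) : {pred (M -> R) -> R^o} :=
  fun v => `[< derivation_at p v >].

Lemma tangent_pred_submod (p : M) : submod_closed (tangent_pred p).
Proof.
split; first by apply/asboolP; split=> *; rewrite /= ?(mulr0, mul0r) ?addr0.
move=> a u v /asboolP[u0 uD uM] /asboolP[v0 vD vM]; apply/asboolP.
have E f : (a *: u + v) f = a * u f + v f by [].
split=> [f nf|b f h sf sh|f h sf sh]; rewrite !E.
- by rewrite u0 // v0 // mulr0 addr0.
- by rewrite uD // vD // !mulrDr addrACA mulrCA.
- by rewrite uM // vM // !mulrDr !mulrDl addrACA mulrA [a * (f p * _)]mulrCA.
Qed.

HB.instance Definition _ (p : M) :=
  GRing.isSubmodClosed.Build R ((M -> R) -> R^o) (tangent_pred p)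
    (tangent_pred_submod p).

Record tangent (p : M) := Tangent {
  tangent_fun :> (M -> R) -> R^o;
  _ : tangent_fun \in tangent_pred p
}.

HB.instance Definition _ (p : M) := [isSub for @tangent_fun p].
HB.instance Definition _ (p : M) := [Choice of tangent p by <:].
HB.instance Definition _ (p : M) :=
  [SubChoice_isSubLmodule of tangent p by <:].

End TangentSpace.

Definition is_basis (R : realType) (V : lmodType R) (b : 'I_4 -> V) : Prop :=
  forall y, exists! a : 'rV[R]_4, y = \sum_(i < 4) a 0 i *: b i.

Section VectorFields.
Variables (R : realType) (M : manifold4 R).

(* Not necessarily smooth sections of the tangent bundle; a vector field on an
   open set is represented by any section extending it. *)
Definition vfield : Type := forall p : M, tangent p.

Definition vsmooth_at (p : M) (X : vfield) : Prop :=
  \forall q \near p, forall f,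
    smooth_at q f -> smooth_at q (fun r => X r f).

(* Where [X] and [Y] are smooth the commutator is a derivation and [insubd]
   returns it; elsewhere the value is irrelevant. *)
Definition lie_bracket (X Y : vfield) : vfield := fun p =>
  insubd (0 : tangent p) (fun f : M -> R =>
    if `[< smooth_at p f >]
    then X p (fun q => Y q f) - Y p (fun q => X q f) else 0).

End VectorFields.

Section RiemannianGeometry.
Variables (R : realType) (M : manifold4 R).
Variable g : forall p : M, tangent p -> tangent p -> R.

Definition riemannian_metric : Prop :=
  [/\ forall p (a : R) (x y z : tangent p),
        g (a *: x + y) z = a * g x z + g y z,
      forall p (x y : tangent p), g x y = g y x,
      forall p (x : tangent p), x != 0 -> 0 < g x x
    & forall p (X Y : vfield M), vsmooth_at p X -> vsmooth_at p Y ->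
        smooth_at p (fun q => g (X q) (Y q))].

(* The axioms are imposed at every point on the fields smooth there, so that
   [nabla] restricts to vector fields on open subsets. *)
Definition affine_connection
    (nabla : vfield M -> vfield M -> vfield M) : Prop :=
  forall (p : M) (f : M -> R) (X Y Z : vfield M),
    smooth_at p f -> vsmooth_at p X -> vsmooth_at p Y -> vsmooth_at p Z ->
  [/\ vsmooth_at p (nabla X Y),
      nabla (fun q => f q *: X q + Y q) Z p
        = f p *: nabla X Z p + nabla Y Z p,
      nabla X (fun q => Y q + Z q) p = nabla X Y p + nabla X Z p
    & nabla X (fun q => f q *: Y q) p = X p f *: Y p + f p *: nabla X Y p].

Definition levi_civita (nabla : vfield M -> vfield M -> vfield M) : Prop :=
  affine_connection nabla /\
  forall (p : M) (X Y Z : vfield M),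
    vsmooth_at p X -> vsmooth_at p Y -> vsmooth_at p Z ->
    nabla X Y p - nabla Y X p = lie_bracket X Y p /\
    X p (fun q => g (Y q) (Z q))
      = g (nabla X Y p) (Z p) + g (Y p) (nabla X Z p).

Definition curvature_operator (nabla : vfield M -> vfield M -> vfield M)
    (X Y Z : vfield M) : vfield M := fun p =>
  nabla X (nabla Y Z) p - nabla Y (nabla X Z) p - nabla (lie_bracket X Y) Z p.

(* Every tangent vector extends to a field smooth at its base point, so this
   determines [Rm]; it is satisfiable because the right-hand side is
   tensorial. *)
Definition curvature_tensor (nabla : vfield M -> vfield M -> vfield M)
    (Rm : forall p : M, tangent p -> tangent p -> tangent p -> tangent p -> R)
    : Prop :=
  forall (p : M) (X Y Z U : vfield M),
    vsmooth_at p X -> vsmooth_at p Y -> vsmooth_at p Z -> vsmooth_at p U ->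
    Rm p (X p) (Y p) (Z p) (U p) = g (curvature_operator nabla X Y Z p) (U p).

Definition sectional_curvature
    (Rm : forall p : M, tangent p -> tangent p -> tangent p -> tangent p -> R)
    (p : M) (x y : tangent p) : R :=
  Rm p x y x y / (g x x * g y y - g x y ^+ 2).

Definition skew_circulant_mx : 'M[R]_4 := \matrix_(i < 4, j < 4)
  nth 0 (nth [::] [:: [::  0; 1; 0; 0];
                      [::  0; 0; 1; 0];
                      [::  0; 0; 0; 1];
                      [:: -1; 0; 0; 0]] i) j.

Definition metric_mx (A B : R) : 'M[R]_4 := \matrix_(i < 4, j < 4)
  nth 0 (nth [::] [:: [::  A; B; 0; -B];
                      [::  B; A; B;  0];
                      [::  0; B; A;  B];
                      [:: -B; 0; B;  A]] i) j.

(* The equations with [metric_mx] already follow from the isometry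
   condition; the frame [e] need not be a coordinate frame. *)
Definition skew_circulant_structure
    (S : forall p : M, {linear tangent p -> tangent p}) : Prop :=
  [/\ forall p (X : vfield M), vsmooth_at p X ->
        vsmooth_at p (fun q => S q (X q)),
      forall p (x y : tangent p), g (S p x) (S p y) = g x y
    & forall p : M, exists (e : 'I_4 -> vfield M) (A B : M -> R),
        \forall q \near p,
        [/\ (forall i, vsmooth_at q (e i)) /\ is_basis (fun i => e i q),
            forall i, S q (e i q) = \sum_(j < 4) skew_circulant_mx i j *: e j q,
            smooth_at q A /\ smooth_at q B,
            forall i j, g (e i q) (e j q) = metric_mx (A q) (B q) i j
          & Num.sqrt 2 * B q < A q /\ 0 < Num.sqrt 2 * B q]].

End RiemannianGeometry.

Definition induces_S_basis (R : realType) (M : manifold4 R)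
    (S : forall p : M, {linear tangent p -> tangent p})
    (p : M) (x : tangent p) : Prop :=
  is_basis (fun i : 'I_4 =>
    nth 0 [:: S p (S p (S p x)); S p (S p x); S p x; x] i).

(* Main.v *)
Require Import Defs.
From mathcomp Require Import all_boot all_order all_algebra.
From mathcomp Require Import all_classical all_reals all_analysis.

(** Applying [S] to both arguments changes neither the numerator nor the
    denominator of [k], since [R] and [g] are both [S]-invariant; so
    [k (S y) (S z) = k y z].  This is all there is to three of the four
    equalities.  In the remaining one, [k S2x S3x = k S3x x], applying [S] to
    the left-hand side gives [k S3x (S S3x)], and [S^4 = - id]
    ([skew_circulant4]) turns it into [k S3x (- x)].  The claim is thus that
    [k] is even in its second argument: the denominator clearly is, and the
    numerator is because [R] is homogeneous in its second and fourth arguments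
    ([curvature_tensorZ]).

    The tensor is only known through its values on smooth fields, so this
    homogeneity comes from the connection.  Tangent vectors extend to smooth
    fields with constant coefficients in a local frame ([smooth_extension]),
    and [nabla] and the bracket commute with constant factors.  These
    identities hold at points near [p] only, whereas the outer [nabla] in the
    second covariant derivatives takes global fields as arguments; hence the
    need for the locality of a connection ([nabla_locall], [nabla_localr]).
    Smoothness of the bracket itself follows from its being the difference
    [nabla X Y - nabla Y X]. *)

Set Implicit Arguments.
Unset Strict Implicit.
Unset Printing Implicit Defensive.

Import Order.TTheory GRing.Theory Num.Theory.
Import numFieldNormedType.Exports.

Local Open Scope classical_set_scope.
Local Open Scope ring_scope.

(** * Functions of class C^k on open sets of the model space *)

Section Functions.
Variable R : realType.
Implicit Types (U V : set 'rV[R]_4) (f h : 'rV[R]_4 -> R).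

Lemma Ck_on_sub k U V f : V `<=` U -> Ck_on k U f -> Ck_on k V f.
Proof.
move=> VU; elim: k f => [|k IH] f [cf df];
  (split; first by move=> x /VU/cf) => //.
by move=> i; have [dfi Cfi] := df i; split; [move=> x /VU/dfi | exact: IH].
Qed.

(** Openness of [U] is what lets the derivatives see the equality. *)
Lemma Ck_on_eq k U f h : open U -> {in U, f =1 h} -> Ck_on k U f -> Ck_on k U h.
Proof.
move=> oU; elim: k f h => [|k IH] f h fh [cf df];
  have nfh x (Ux : U x) : {near x, f =1 h} by
    apply: filterS (open_nbhs_nbhs (conj oU Ux)) => y Uy;
    apply: fh; rewrite inE.
all: have ch x : U x -> {for x, continuous h} by
  move=> Ux; rewrite /prop_for /continuous_at -(nbhs_singleton (nfh x Ux));
  exact: cvg_trans (near_eq_cvg (nfh x Ux)) (cf x Ux).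
  by [].
split=> // i; have [dfi Cfi] := df i; split=> [x Ux|].
  by apply: near_eq_derivable (dfi x Ux); exact: nfh.
apply: IH Cfi => x; rewrite inE => Ux.
by rewrite /partial; apply: near_eq_derive; exact: nfh.
Qed.

Lemma Ck_on_cst k U (a : R) : Ck_on k U (cst a).
Proof.
elim: k a => [|k IH] a;
  (split; first by move=> x _; exact: cst_continuous) => //.
move=> i; split=> [x _|]; first exact: derivable_cst.
suff -> : partial i (cst a : _ -> R) = cst 0 by exact: IH.
by apply/funext => x; rewrite /partial derive_cst.
Qed.

Lemma Ck_on_lin k U (a : R) f h : open U -> Ck_on k U f -> Ck_on k U h ->
  Ck_on k U (fun x => a * f x + h x).
Proof.
move=> oU; elim: k f h => [|k IH] f h [cf df] [ch dh].
  by split=> // x Ux; exact: cvgD (cvgM (cvg_cst a) (cf x Ux)) (ch x Ux).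
split=> [x Ux|i].
  by exact: cvgD (cvgM (cvg_cst a) (cf x Ux)) (ch x Ux).
have [dfi Cfi] := df i; have [dhi Chi] := dh i; split=> [x Ux|].
  by apply: derivableD; [apply: derivableZ; exact: dfi | exact: dhi].
apply: (Ck_on_eq oU) (IH _ _ Cfi Chi) => x; rewrite inE => Ux.
rewrite /partial.
have -> : (fun x => a * f x + h x) = (a \*: f) + h :> (_ -> R) by [].
rewrite deriveD; [|by apply: derivableZ; exact: dfi|exact: dhi].
by rewrite deriveZ//; exact: dfi.
Qed.

End Functions.

(** * Germs of smooth functions and derivations *)

Section Germs.
Variables (R : realType) (M : manifold4 R).
Implicit Types (p q : M) (W : set M) (f h : M -> R).

Lemma chart_image_open (c : chart R M) W :
  open W -> open (chart_map c @` (chart_dom c `&` W)).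
Proof.
move=> oW; set D := chart_map c @` chart_dom c.
have oD : open D := @chart_img_open _ _ c.
have ci := @chart_inv_continuous _ _ c.
rewrite continuous_open_subspace // in ci.
rewrite openE => _ [q [cq Wq] <-].
have Dq : D (chart_map c q) by exists q.
have nW : nbhs (chart_map c q) (chart_inv c @^-1` W).
  by apply: ci; rewrite ?inE// chart_mapK//; exact: open_nbhs_nbhs.
have nD : nbhs (chart_map c q) D by exact: open_nbhs_nbhs.
rewrite /interior; apply: filterS2 nD nW => _ [r cr <-] /=.
by rewrite chart_mapK// => Wr; exists r.
Qed.

Lemma smooth_in_sub W W' f : W' `<=` W -> smooth_in W f -> smooth_in W' f.
Proof.
move=> W'W sf c ac k; apply: Ck_on_sub (sf c ac k).
by apply: image_subset; exact: setIS.
Qed.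

Lemma smooth_in_eq W f h :
  open W -> {in W, f =1 h} -> smooth_in W f -> smooth_in W h.
Proof.
move=> oW fh sf c ac k; apply: Ck_on_eq (sf c ac k).
  exact: chart_image_open.
move=> x; rewrite inE => -[q [cq Wq] <-] /=; rewrite chart_mapK// fh//.
by rewrite inE.
Qed.

Lemma smooth_at_near_eq p f h :
  {near p, f =1 h} -> smooth_at p f -> smooth_at p h.
Proof.
rewrite /prop_near1 nbhsE => -[V [oV Vp] fh] [W [oW Wp sf]].
exists (W `&` V); split=> //; first exact: openI.
apply: (@smooth_in_eq _ f); first exact: openI.
  by move=> q; rewrite inE => -[_ /fh].
by apply: smooth_in_sub sf; exact: subIsetl.
Qed.

Lemma smooth_at_cst p (a : R) : smooth_at p (fun=> a).
Proof.
by exists setT; split=> // [|c _ k]; [exact: openT | exact: Ck_on_cst].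
Qed.

Lemma smooth_at_lin p (a : R) f h : smooth_at p f -> smooth_at p h ->
  smooth_at p (fun q => a * f q + h q).
Proof.
move=> [W [oW Wp sf]] [V [oV Vp sh]]; exists (W `&` V).
split=> //; first exact: openI.
move=> c ac k; apply: Ck_on_lin.
- by apply: chart_image_open; exact: openI.
- by apply: (smooth_in_sub _ sf) => //; exact: subIsetl.
- by apply: (smooth_in_sub _ sh) => //; exact: subIsetr.
Qed.

(** The Leibniz rule for [1 = 1 * 1] gives [v 1 = v 1 + v 1]. *)
Lemma tangent_cst p (v : tangent p) (a : R) : v (fun=> a) = 0.
Proof.
case: v => v /= /asboolP[_ vD vM].
have s := smooth_at_cst p.
have v1 : v (fun=> 1) = 0.
  have := vM _ _ (s 1) (s 1); rewrite mulr1 mul1r mulr1.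
  by move/esym/eqP; rewrite -subr_eq0 addrK => /eqP.
have v0 : v (fun=> 0) = 0.
  have := vD 1 _ _ (s 0) (s 0); rewrite mulr0 addr0 mul1r.
  by move/esym/eqP; rewrite -subr_eq0 addrK => /eqP.
by have := vD a _ _ (s 1) (s 0); rewrite mulr1 addr0 v1 v0 mulr0 addr0.
Qed.

End Germs.

(** * Smooth vector fields *)

Section Fields.
Variables (R : realType) (M : manifold4 R).
Implicit Types (p q : M) (X Y Z : vfield M).

Lemma vsmooth_at_near p X : vsmooth_at p X -> \forall q \near p, vsmooth_at q X.
Proof. exact: near_join. Qed.

Lemma vsmooth_at_near_eq p X Y :
  (\forall q \near p, X q = Y q) -> vsmooth_at p X -> vsmooth_at p Y.
Proof.
move=> /near_join XY; rewrite /vsmooth_at; apply: filterS2 XY => q XYq sX f sf.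
by apply: smooth_at_near_eq (sX f sf); apply: filterS XYq => r ->.
Qed.

Lemma vsmooth_at0 p : vsmooth_at p (fun q => 0 : tangent q).
Proof. by apply: nearW => q f _; exact: smooth_at_cst. Qed.

Lemma vsmooth_at_lin p (a : R) X Y : vsmooth_at p X -> vsmooth_at p Y ->
  vsmooth_at p (fun q => a *: X q + Y q).
Proof.
rewrite /vsmooth_at; apply: filterS2 => q sX sY f sf.
by apply: smooth_at_lin; [exact: sX | exact: sY].
Qed.

Lemma vsmooth_atZ p (a : R) X :
  vsmooth_at p X -> vsmooth_at p (fun q => a *: X q).
Proof.
move=> sX; apply: vsmooth_at_near_eq (vsmooth_at_lin a sX (vsmooth_at0 p)).
by apply: nearW => q; rewrite addr0.
Qed.

Lemma vsmooth_at_sum p n (a : 'I_n -> R) (e : 'I_n -> vfield M) :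
  (forall i, vsmooth_at p (e i)) ->
  vsmooth_at p (fun q => \sum_(i < n) a i *: e i q).
Proof.
elim: n a e => [|n IH] a e se.
  by apply: vsmooth_at_near_eq (vsmooth_at0 p);
  apply: nearW => q; rewrite big_ord0.
have stail := IH (a \o lift ord0) _ (fun i => se (lift ord0 i)).
apply: vsmooth_at_near_eq (vsmooth_at_lin (a ord0) (se ord0) stail).
by apply: nearW => q; rewrite big_ord_recl.
Qed.

Lemma smooth_extension p (e : 'I_4 -> vfield M) (x : tangent p) :
  (forall i, vsmooth_at p (e i)) -> is_basis (fun i => e i p) ->
  exists2 X : vfield M, vsmooth_at p X & X p = x.
Proof.
move=> se be; have [a [-> _]] := be x.
by exists (fun q => \sum_(i < 4) a 0 i *: e i q) => //; exact: vsmooth_at_sum.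
Qed.

(** This is the substitute for a bump function in the proof that a connection
    is local: since smoothness is only asked of germs at [p], the cut-off [f]
    can be the indicator function of the set where [X] and [Y] differ. *)
Lemma cutoff_eq p X Y : vsmooth_at p X -> vsmooth_at p Y ->
  (\forall q \near p, X q = Y q) ->
  exists f : M -> R, exists D : vfield M,
    [/\ smooth_at p f /\ f p = 0, vsmooth_at p D /\ D p = 0,
        vsmooth_at p (fun q => f q *: D q)
      & X = (fun q => f q *: D q + Y q)].
Proof.
move=> sX sY XY; pose f q : R := if `[< X q = Y q >] then 0 else 1.
pose D : vfield M := fun q => (-1) *: Y q + X q.
have f0 : \forall q \near p, f q = 0.
  by apply: filterS XY => q XYq; rewrite /f asboolT.
have XYp : X p = Y p := nbhs_singleton XY.
exists f, D; split.
- split; last exact: nbhs_singleton f0.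
  apply: smooth_at_near_eq (smooth_at_cst p 0).
  by apply: filterS f0 => q ->.
- split; first exact: vsmooth_at_lin.
  by rewrite /D XYp scaleN1r addNr.
- apply: vsmooth_at_near_eq (vsmooth_at0 p).
  by apply: filterS f0 => q ->; rewrite scale0r.
- apply: functional_extensionality_dep => q; rewrite /f /D.
  case: asboolP => [->|_]; first by rewrite scale0r add0r.
  by rewrite scale1r scaleN1r addrAC addNr add0r.
Qed.

End Fields.

(** * Connections and their curvature *)

Section Connections.
Variables (R : realType) (M : manifold4 R).
Variable nabla : vfield M -> vfield M -> vfield M.
Hypothesis aff : affine_connection nabla.
Implicit Types (p q : M) (X Y Z : vfield M).

Lemma nabla_smooth p X Y :
  vsmooth_at p X -> vsmooth_at p Y -> vsmooth_at p (nabla X Y).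
Proof. by move=> sX sY; have [] := aff (smooth_at_cst p 0) sX sY sY. Qed.

Lemma nabla_locall p X Y Z :
  vsmooth_at p X -> vsmooth_at p Y -> vsmooth_at p Z ->
  (\forall q \near p, X q = Y q) -> nabla X Z p = nabla Y Z p.
Proof.
move=> sX sY sZ /(cutoff_eq sX sY)[f [D [[sf f0] [sD _] _ ->]]].
by have [_ -> _ _] := aff sf sD sY sZ; rewrite f0 scale0r add0r.
Qed.

(** The Leibniz rule for the field [f D] of [cutoff_eq] leaves two terms, one
    killed by [D p = 0] and the other by [f p = 0]. *)
Lemma nabla_localr p X Y Z :
  vsmooth_at p X -> vsmooth_at p Y -> vsmooth_at p Z ->
  (\forall q \near p, Y q = Z q) -> nabla X Y p = nabla X Z p.
Proof.
move=> sX sY sZ /(cutoff_eq sY sZ)[f [D [[sf f0] [sD D0] sfD ->]]].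
have [_ _ -> _] := aff sf sX sfD sZ.
by have [_ _ _ ->] := aff sf sX sD sZ; rewrite D0 f0 scaler0 scale0r !add0r.
Qed.

Lemma nablaZr p (a : R) X Y : vsmooth_at p X -> vsmooth_at p Y ->
  nabla X (fun q => a *: Y q) p = a *: nabla X Y p.
Proof.
move=> sX sY; have [_ _ _ ->] := aff (smooth_at_cst p a) sX sY sY.
by rewrite tangent_cst scale0r add0r.
Qed.

Lemma nablaZl p (a : R) X Y : vsmooth_at p X -> vsmooth_at p Y ->
  nabla (fun q => a *: X q) Y p = a *: nabla X Y p.
Proof.
move=> sX sY.
(* The axiom only speaks of sums, so a zero field is added; the case b = 1
   then shows that its contribution vanishes. *)
have split b : nabla (fun q => b *: X q) Y p =
    b *: nabla X Y p + nabla (fun q => 0) Y p.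
  have [_ <- _ _] := aff (smooth_at_cst p b) sX (vsmooth_at0 p) sY.
  congr (nabla _ Y p); apply: functional_extensionality_dep => q.
  by rewrite addr0.
rewrite split; suff -> : nabla (fun q => 0) Y p = 0 by rewrite addr0.
have := split 1; have -> : (fun q => 1 *: X q) = X.
  by apply: functional_extensionality_dep => q; rewrite scale1r.
by rewrite scale1r => /esym/eqP; rewrite -subr_eq0 addrAC subrr add0r => /eqP.
Qed.

Hypothesis torsion_free : forall p X Y, vsmooth_at p X -> vsmooth_at p Y ->
  nabla X Y p - nabla Y X p = lie_bracket X Y p.

(** Torsion-freeness holds at every point near [p], where it exhibits the
    bracket as a combination of smooth fields. *)
Lemma lie_bracket_smooth p X Y :
  vsmooth_at p X -> vsmooth_at p Y -> vsmooth_at p (lie_bracket X Y).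
Proof.
move=> sX sY; apply: vsmooth_at_near_eq
  (vsmooth_at_lin (-1) (nabla_smooth sY sX) (nabla_smooth sX sY)).
near=> q; rewrite scaleN1r addrC; apply: torsion_free.
- by near: q; exact: vsmooth_at_near.
- by near: q; exact: vsmooth_at_near.
Unshelve. all: by end_near. Qed.

Lemma lie_bracketZr p (a : R) X Y : vsmooth_at p X -> vsmooth_at p Y ->
  lie_bracket X (fun q => a *: Y q) p = a *: lie_bracket X Y p.
Proof.
move=> sX sY; rewrite -!torsion_free ?nablaZr ?nablaZl ?scalerBr//.
exact: vsmooth_atZ.
Qed.

(** In the first and third terms of the curvature the factor [a] can only be
    taken out of the inner field near [p]; locality of [nabla] makes this
    enough. *)
Lemma curvature_operatorZ p (a : R) X Y Z :
  vsmooth_at p X -> vsmooth_at p Y -> vsmooth_at p Z ->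
  curvature_operator nabla X (fun q => a *: Y q) Z p
    = a *: curvature_operator nabla X Y Z p.
Proof.
move=> sX sY sZ; have saY := vsmooth_atZ a sY; rewrite /curvature_operator.
have nX := vsmooth_at_near sX; have nY := vsmooth_at_near sY.
have nZ := vsmooth_at_near sZ.
have E1 : nabla X (nabla (fun q => a *: Y q) Z) p = a *: nabla X (nabla Y Z) p.
  rewrite -nablaZr//; last exact: nabla_smooth.
  apply: nabla_localr => //.
  - exact: nabla_smooth.
  - by apply: vsmooth_atZ; exact: nabla_smooth.
  - by apply: filterS2 nY nZ => q; exact: nablaZl.
have E2 : nabla (lie_bracket X (fun q => a *: Y q)) Z p
        = a *: nabla (lie_bracket X Y) Z p.
  rewrite -nablaZl//; last exact: lie_bracket_smooth.
  apply: nabla_locall => //.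
  - exact: lie_bracket_smooth.
  - by apply: vsmooth_atZ; exact: lie_bracket_smooth.
  - by apply: filterS2 nX nY => q; exact: lie_bracketZr.
rewrite E1 E2 nablaZl//; last exact: nabla_smooth.
by rewrite !scalerBr.
Qed.

End Connections.

(** * Sectional curvatures of the basic planes *)

Lemma metricZl (R : realType) (M : manifold4 R)
    (g : forall p : M, tangent p -> tangent p -> R) (p : M) (a : R)
    (v w : tangent p) :
  riemannian_metric g -> g p (a *: v) w = a * g p v w.
Proof.
move=> [gl _ _ _]; have g0 : g p 0 w = 0.
  have := gl p 1 0 0 w; rewrite scaler0 addr0 mul1r.
  by move/esym/eqP; rewrite -subr_eq0 addrK => /eqP.
by rewrite -[a *: v]addr0 gl g0 addr0.
Qed.

(** The frame [e] serves to extend the four vectors to smooth fields, the only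
    arguments on which [Rm] is determined by [nabla]. *)
Lemma curvature_tensorZ (R : realType) (M : manifold4 R)
    (g : forall p : M, tangent p -> tangent p -> R)
    (nabla : vfield M -> vfield M -> vfield M)
    (Rm : forall p : M, tangent p -> tangent p -> tangent p -> tangent p -> R)
    (p : M) (e : 'I_4 -> vfield M) (a : R) (x y z u : tangent p) :
  riemannian_metric g -> levi_civita g nabla -> curvature_tensor g nabla Rm ->
  (forall i, vsmooth_at p (e i)) -> is_basis (fun i => e i p) ->
  Rm p x (a *: y) z (a *: u) = a ^+ 2 * Rm p x y z u.
Proof.
move=> hg [aff lc] hRm se be.
have ext := smooth_extension _ se be.
have [X sX <-] := ext x; have [Y sY <-] := ext y.
have [Z sZ <-] := ext z; have [U sU <-] := ext u.
have tf q V W : vsmooth_at q V -> vsmooth_at q W ->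
    nabla V W q - nabla W V q = lie_bracket V W q.
  by move=> sV sW; have [] := lc q V W W sV sW sW.
have saY := vsmooth_atZ a sY; have saU := vsmooth_atZ a sU.
rewrite (hRm p _ _ _ _ sX saY sZ saU) hRm//.
have [_ gC _ _] := hg.
have gZ := metricZl _ _ _ hg.
by rewrite curvature_operatorZ// gZ gC gZ gC mulrA.
Qed.

(** [s] shifts the basis cyclically up to a sign picked up on passing from the
    last vector to the first, so four steps negate each basis vector. *)
Lemma skew_circulant4 (R : realType) (V : lmodType R)
    (s : {linear V -> V}) (e : 'I_4 -> V) (x : V) :
  is_basis e ->
  (forall i, s (e i) = \sum_(j < 4) skew_circulant_mx R i j *: e j) ->
  s (s (s (s x))) = - x.
Proof.
move=> be se.
(* Indexing the basis by naturals lets the shift be iterated by rewriting. *)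
pose e_ k := e (inord k).
have E i : s (e i) = if i == 3 :> nat then - e_ 0%N else e_ i.+1.
  rewrite se.
  have -> : \sum_(j < 4) skew_circulant_mx R i j *: e j =
    \sum_(j < 4) skew_circulant_mx R i j *: e_ j.
    by apply: eq_bigr => j _; rewrite /e_ inord_val.
  rewrite !big_ord_recl big_ord0 !mxE.
  case: i => -[|[|[|[|//]]]] Hi /=;
  by rewrite ?scale0r ?scale1r ?scaleN1r ?add0r ?addr0.
have E_ k : (k < 4)%N -> s (e_ k) = if k == 3 then - e_ 0%N else e_ k.+1.
  by move=> k4; rewrite /e_ E inordK.
have e4 i : s (s (s (s (e i)))) = - e i.
  rewrite -[i]inord_val -/(e_ i); case: i => -[|[|[|[|//]]]] Hi /=;
  by do ![rewrite E_ //= | rewrite linearN /=].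
have [a [-> _]] := be x.
rewrite -sumrN !linear_sum /=.
by apply: eq_bigr => i _; rewrite !linearZ /= e4 scalerN.
Qed.

Theorem theorem4p1 (R : realType) (M : manifold4 R)
    (g : forall p : M, tangent p -> tangent p -> R)
    (S : forall p : M, {linear tangent p -> tangent p})
    (nabla : vfield M -> vfield M -> vfield M)
    (Rm : forall p : M, tangent p -> tangent p -> tangent p -> tangent p -> R)
    (hg : riemannian_metric g)
    (hS : skew_circulant_structure g S)
    (hnabla : levi_civita g nabla)
    (hRm : curvature_tensor g nabla Rm)
    (hRS : forall (p : M) (x y z u : tangent p),
       Rm p (S p x) (S p y) (S p z) (S p u) = Rm p x y z u)
    (p : M) (x : tangent p) (hx : induces_S_basis S x) :
  let k := sectional_curvature g Rm (p := p) in
  let Sx := S p x in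
  let S2x := S p Sx in
  let S3x := S p S2x in
  [/\ k x Sx = k Sx S2x, k Sx S2x = k S2x S3x, k S2x S3x = k S3x x
    & k x S2x = k Sx S3x].
Proof.
move=> k Sx S2x S3x.
have [_ gS loc] := hS.
have kS y z : k (S p y) (S p z) = k y z.
  by rewrite /k /sectional_curvature hRS !gS.
have [e [A [B /nbhs_singleton[[se be] Se _ _ _]]]] := loc p.
have kN y z : k y (- z) = k y z.
  have gN v w : g p (- v) w = - g p v w.
    by rewrite -scaleN1r (metricZl _ _ _ hg) mulN1r.
  have gNr v w : g p v (- w) = - g p v w.
    by have [_ gC _ _] := hg; rewrite gC gN gC.
  rewrite /k /sectional_curvature gN !gNr opprK sqrrN.
  have RmZ := curvature_tensorZ _ _ _ _ _ hg hnabla hRm se be.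
  by rewrite -(scaleN1r z) RmZ sqrrN expr1n mul1r.
split; [by rewrite [RHS]kS | by rewrite [RHS]kS | | by rewrite [RHS]kS].
by rewrite -[RHS]kN -(skew_circulant4 x be Se) [RHS]kS.
Qed.
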